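(* Let $N\ge 2$ be an integer. If $M$ is an integer with $M \geq R_{N-1}-2N+1$, then for all positive integers $m \geq M$ and all integers $n$ with $3\le n \leq N$, $$\mathfrak{pr}(P_m+C_n) = \begin{cases} m+2n-2 & \text{if } m \text{ is odd},\\ m+2n-1 & \text{if } m \text{ is even}.\end{cases}$$
   Context: All graphs are finite and simple. A coprime labeling of a graph $G$ is an injection $f\colon V(G)\to\{1,2,\dots,k\}$, for some integer $k\ge |V(G)|$, such that $\gcd(f(u),f(v))=1$ whenever $(u,v)\in E(G)$. The minimum coprime number $\mathfrak{pr}(G)$ is the least $k$ for which such a labeling exists. $P_m$ is the path on $m$ vertices and $C_n$ is the cycle on $n\ge 3$ vertices. The join $G+H$ of two disjoint graphs is the union $G\cup H$ together with all edges between a vertex of $G$ and a vertex of $H$. For $k\ge 1$, the $k$-th Ramanujan prime $R_k$ is the least integer such that $\pi(x)-\pi(x/2)\ge k$ for all $x\ge R_k$, where $\pi(x)$ is the number of primes less than or equal to $x$. *)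

(* Defs.v *)
From HB Require Import structures.
From mathcomp Require Import all_boot all_order all_algebra.
From mathcomp Require Import reals.

Set Implicit Arguments.
Unset Strict Implicit.
Unset Printing Implicit Defensive.

Import Order.TTheory GRing.Theory Num.Theory.

Record sgraph := SGraph {
  vertex :> finType;
  adj : rel vertex;
  adj_sym : symmetric adj;
  adj_irr : irreflexive adj
}.

Section PathCycle.
Variable n : nat.

Definition path_rel : rel 'I_n :=
  fun i j => (i.+1 == j :> nat) || (j.+1 == i :> nat).

Lemma path_rel_sym : symmetric path_rel.
Proof. by move=> i j; rewrite /path_rel orbC. Qed.

Lemma path_rel_irr : irreflexive path_rel.
Proof. by move=> i; rewrite /path_rel orbb gtn_eqF. Qed.

Definition path_graph : sgraph := SGraph path_rel_sym path_rel_irr.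

(* The test i != j only matters for n = 1, where ordS i = i. *)
Definition cycle_rel : rel 'I_n :=
  fun i j => (i != j) && ((ordS i == j) || (ordS j == i)).

Lemma cycle_rel_sym : symmetric cycle_rel.
Proof. by move=> i j; rewrite /cycle_rel eq_sym orbC. Qed.

Lemma cycle_rel_irr : irreflexive cycle_rel.
Proof. by move=> i; rewrite /cycle_rel eqxx. Qed.

Definition cycle_graph : sgraph := SGraph cycle_rel_sym cycle_rel_irr.

End PathCycle.

Section Join.
Variables G H : sgraph.

Definition join_rel : rel (G + H)%type := fun u v =>
  match u, v with
  | inl x, inl y => adj x y
  | inr x, inr y => adj x y
  | _, _ => true
  end.

Lemma join_rel_sym : symmetric join_rel.
Proof. by move=> [x|x] [y|y] //=; rewrite adj_sym. Qed.

Lemma join_rel_irr : irreflexive join_rel.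
Proof. by move=> [x|x] /=; rewrite adj_irr. Qed.

Definition join_graph : sgraph := SGraph join_rel_sym join_rel_irr.

End Join.

Section CoprimeNumber.
Variable G : sgraph.

Definition coprime_labeling (k : nat) (f : {ffun G -> 'I_k.+1}) : bool :=
  [&& injectiveb f,
      [forall v, 0 < f v] &
      [forall u, forall v, adj u v ==> coprime (f u) (f v)]].

Definition coprime_labelable (k : nat) : bool :=
  (#|G| <= k) && [exists f : {ffun G -> 'I_k.+1}, coprime_labeling f].

(* Distinct primes always give a coprime labeling. *)
Lemma coprime_labelable_ex : exists k, coprime_labelable k.
Proof.
pose next p := s2val (prime_above p).
pose q i := iter i next 2.
have q_prime i : prime (q i) by case: i => // i; exact: (s2valP' (prime_above _)).
have q_lt : {homo q : i j / i < j}.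
  apply: homo_ltn => [|i]; first exact: ltn_trans.
  exact: (s2valP (prime_above (q i))).
have q_inj : injective q.
  by move=> i j e; case: (ltngtP i j) => // /q_lt; rewrite e ltnn.
have q_ge i : i < q i.
  by elim: i => // i IHi; apply: leq_ltn_trans IHi (q_lt i i.+1 _).
pose k := q #|G|.
pose f := [ffun v : G => inord (q (enum_rank v)) : 'I_k.+1].
have fE v : f v = q (enum_rank v) :> nat.
  by rewrite ffunE inordK // ltnS ltnW // q_lt.
have f_inj : injective f.
  by move=> u v /(congr1 val) /=; rewrite !fE => /q_inj /val_inj /enum_rank_inj.
exists k; rewrite /coprime_labelable ltnW //=; apply/existsP; exists f.
apply/and3P; split; first exact/injectiveP.
  by apply/forallP => v; rewrite fE prime_gt0.
apply/forallP => u; apply/forallP => v; apply/implyP => uv.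
rewrite !fE prime_coprime // dvdn_prime2 //; apply/eqP => e.
by move: uv; rewrite (enum_rank_inj (val_inj (q_inj _ _ e))) adj_irr.
Qed.

Definition min_coprime_number : nat := ex_minn coprime_labelable_ex.

End CoprimeNumber.

Section RamanujanPrime.
Variable R : realType.
Local Open Scope ring_scope.

(* Num.truncn x is the integer part of x when 0 <= x, and 0 otherwise. *)
Definition prime_pi (x : R) : nat := count prime (iota 0 (Num.truncn x).+1).

Definition ramanujan_bound (k : nat) (r : int) : Prop :=
  forall x : R, r%:~R <= x ->
    k%:Z <= (prime_pi x)%:Z - (prime_pi (x / 2))%:Z.

Definition is_ramanujan_prime (k : nat) (r : int) : Prop :=
  ramanujan_bound k r /\ forall s : int, ramanujan_bound k s -> r <= s.

End RamanujanPrime.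

(* Main.v *)
Require Import Defs.
From HB Require Import structures.
From mathcomp Require Import all_boot all_order all_algebra.
From mathcomp Require Import reals.
From mathcomp Require Import zify.

Import Order.TTheory GRing.Theory Num.Theory.

(** Put [Y = m./2 + n]; in both parities the claimed value is [2 * Y - 1].

    Lower bound.  Even labels cannot sit on adjacent vertices.  As all path
    vertices are adjacent to all cycle vertices, only one of the two parts can
    carry even labels, and there they form an independent set.  If it is the
    path, at most [uphalf m] labels are even, so at least [m./2 + n = Y]
    distinct odd labels occur and the largest one is at least [2 * Y - 1].  If
    it is the cycle, at least as many odd labels are needed, provided that [m]
    is not small compared with [n] ([join_path_cycle_labelable_ge]).  That [m > N]
    follows from the hypothesis on the Ramanujan prime: half of the numbers in
    [(y, 2y]] are even, so for [3N <= 2y + 1] there is no room for [N - 1]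
    primes in such an interval with [y] small ([ramanujan_bound_lower]).

    Upper bound.  Call a prime in [(Y, 2Y)] large; it is coprime to every other
    number below [2Y].  The cycle receives 1 and the [n - 1] smallest large
    primes, of which [q] denotes the greatest.  The path must then use all the
    other odd numbers up to [2Y - 1], separated by even ones.  Arrange these odd
    numbers on a circle in increasing order.  Between the ends of each gap
    stands one even number coprime to both ([even_between]): the neighbours
    [2Y - 1] and 3 are separated by 2, and a gap is never longer than 6 because
    one of three consecutive odd numbers is a multiple of 3.  The gap around [q]
    is where the circle is cut open, so that it provides two even numbers, one
    for each end of the path.  Hence the path reads
    [q + 1, q + 2, ..., 2Y - 1, 2, 3, 4, ...] and ends just below [q]
    ([increasing_coprime_chain], [join_path_cycle_labelable_of_primes]).

    There are [n - 1] large primes: the Ramanujan property gives [N - 1] primes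
    in [(y, 2y]] for [y = Y + (N - n)], and lowering [y] by one loses at most
    one prime ([count_prime_sub]). *)

(** * Coprime sequences of consecutive integers with odd numbers left out *)

Lemma coprime_add_prime p a : prime p -> ~~ (p %| a) -> coprime (a + p) a.
Proof.
move=> pp npa; rewrite /coprime gcdnC gcdnDl -/(coprime a p) coprime_sym.
by rewrite prime_coprime.
Qed.

(** An even number coprime to both ends of a gap [w, w + p + 1], with [w] odd.
    Of the two outermost candidates, [w + 1] is a neighbour of [w] and lies at
    distance [p] from the upper end, while [w + p] is a neighbour of the upper
    end and lies at distance [p] from [w].  So only the divisor [p] can spoil
    them, and since [p] cannot divide two consecutive numbers, one of the two
    works.  The primes 3 and 5 give the gaps 4 and 6 left by one or two missing
    odd numbers. *)
Lemma even_between w p : odd w -> prime p -> odd p ->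
  exists e, [&& w < e < w + p.+1, ~~ odd e, coprime w e & coprime e (w + p.+1)].
Proof.
move=> ow pp op; have p1 := prime_gt1 pp.
have [dvd|ndvd] := boolP (p %| w + p.+1).
  exists (w + p); rewrite coprime_sym coprime_add_prime //.
    by rewrite addnS coprimenS oddD ow op; lia.
  (* otherwise [p] would divide both [w] and [w + 1] *)
  apply: contraL dvd => pw; rewrite dvdn_addr // -addn1 dvdn_addr // dvdn1.
  by rewrite neq_ltn p1 orbT.
exists w.+1; rewrite coprimenS coprime_sym -addSnnS in ndvd *.
by rewrite coprime_add_prime //; [lia | move: ndvd; rewrite dvdn_addl].
Qed.

(** [Q] stands for the odd numbers to be left out.  That no multiple of 3 is in
    [Q] is the only property of primes needed to bound the gaps. *)
Section Chain.
Variable Q : pred nat.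
Hypothesis Q_odd : forall p, Q p -> odd p.
Hypothesis Q_gt3 : forall p, Q p -> 3 < p.
Hypothesis Q_ndvd3 : forall p, Q p -> ~~ (3 %| p).

Lemma count_iota_add2 w : odd w ->
  count Q (iota 0 (w + 2)) = count Q (iota 0 w) + Q w.
Proof.
move=> ow; rewrite iotaD count_cat /= add0n addn0.
suff -> : Q w.+1 = false by rewrite addn0.
by apply/negP => /(Q_odd _) /=; rewrite ow.
Qed.

(** Going down from [x], the next odd number [w] outside [Q] is at distance at
    most 6, since one of [x - 2], [x - 4], [x - 6] is a multiple of 3.  The last
    equation records that the odd numbers strictly between [w] and [x] all lie
    in [Q]; [x] itself may or may not do so. *)
Lemma gap_below x : odd x -> 3 < x -> exists w e,
  [/\ odd w && (2 < w), ~~ Q w && ~~ Q e, w < e < x, coprime w e && coprime e x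
    & x + 2 * count Q (iota 0 w) = w + 2 + 2 * count Q (iota 0 x)].
Proof.
move=> ox x3.
have evQ e : ~~ odd e -> ~~ Q e by apply: contra => /Q_odd.
have cnt2 z w : odd w -> z = w + 2 ->
    count Q (iota 0 z) = count Q (iota 0 w) + Q w.
  by move=> ow ->; apply: count_iota_add2.
have Cx := cnt2 x (x - 2) ltac:(lia) ltac:(lia).
have [q2|nq2] := boolP (Q (x - 2)); last first.
  exists (x - 2), x.-1; rewrite nq2 evQ; last by lia.
  rewrite (negbTE nq2) addn0 in Cx; rewrite -Cx; split=> //; try lia.
  rewrite {1}(_ : x.-1 = (x - 2).+1); last by lia.
  by rewrite coprimenS -{2}(prednK (n := x)) ?coprimenS //; lia.
have x2 := Q_gt3 _ q2; have n2 := Q_ndvd3 _ q2.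
have Cx2 := cnt2 (x - 2) (x - 4) ltac:(lia) ltac:(lia).
rewrite q2 addn1 in Cx.
have [q4|nq4] := boolP (Q (x - 4)); last first.
  have [|e /and4P[we oe c1 c2]] := even_between (x - 4) 3 _ isT isT; first by lia.
  rewrite subnK in we c2; last by lia.
  rewrite (negbTE nq4) addn0 in Cx2.
  by exists (x - 4), e; rewrite nq4 evQ // c1 c2; split=> //; lia.
have x4 := Q_gt3 _ q4; have n4 := Q_ndvd3 _ q4.
have nq6 : ~~ Q (x - 6) by apply/negP => /(Q_ndvd3 _); lia.
have Cx4 := cnt2 (x - 4) (x - 6) ltac:(lia) ltac:(lia).
rewrite q4 addn1 in Cx2; rewrite (negbTE nq6) addn0 in Cx4.
have [|e /and4P[we oe c1 c2]] := even_between (x - 6) 5 _ isT isT; first by lia.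
rewrite subnK in we c2; last by lia.
by exists (x - 6), e; rewrite nq6 evQ // c1 c2; split=> //; lia.
Qed.

(** The sequence 2, 3, 4, ..., [x] without the members of [Q], keeping a single
    even number between any two successive remaining odd ones: each member of
    [Q] thus costs two terms.  The end [x] may itself belong to [Q], so that the
    chain can be run up to a removed prime and then stopped just before it. *)
Lemma increasing_coprime_chain x : odd x -> 2 < x -> exists L,
  [/\ path [rel a b | (a < b) && coprime a b] 2 (rcons L x),
      all [pred a | (a < x) && ~~ Q a] L
    & size L + 2 * count Q (iota 0 x) = x - 3].
Proof.
elim/ltn_ind: x => x IH ox x2; have [->|x3] : x = 3 \/ 3 < x by lia.
  exists [::]; split=> //=.
  have nQ p : p < 4 -> Q p = false.
    by move=> p4; apply/negP => /Q_gt3; lia.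
  by rewrite !nQ.
have [w [e [/andP[ow w2] /andP[nqw nqe] /andP[we ex] /andP[cwe cex] cnt]]] :=
  gap_below x ox x3.
have [L [pL aL sL]] := IH w (ltn_trans we ex) ow w2.
exists (rcons (rcons L w) e); split; last by rewrite !size_rcons; lia.
  by rewrite rcons_path (rcons_path _ _ (rcons L w)) pL !last_rcons /= we ex cwe.
rewrite !all_rcons /= nqw nqe ex (ltn_trans we ex) /=.
by apply: sub_all aL => a /= /andP[aw ->]; rewrite andbT; lia.
Qed.

End Chain.

(** * Coprime labelings of the join *)

(** Discrete intermediate value property, with the jump located at a point of
    [a]. *)
Lemma count_iota_eq (a : pred nat) k b : k < count a (iota 0 b) ->
  exists q, [/\ q < b, a q & count a (iota 0 q) = k].
Proof.
elim: b => // b IH; rewrite -(addn1 b) iotaD count_cat /= add0n addn0.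
have [/IH[q [qb aq <-]] _|bk] := ltnP k (count a (iota 0 b)).
  by exists q; split=> //; lia.
by case ab: (a b) => /= h; [exists b; split=> //; lia | lia].
Qed.

Lemma coprime_prime_lt_double p a : prime p -> 0 < a -> a < 2 * p -> a != p ->
  coprime a p.
Proof.
move=> pp a0 ap nap; rewrite coprime_sym prime_coprime //.
apply/negP => /dvdnP[[|[|k]] ak]; nia.
Qed.

Lemma path_coprime_iota z d : path coprime z (iota z.+1 d).
Proof. by elim: d z => //= d IH z; rewrite coprimenS IH. Qed.

Lemma last_iotaS z d : last z (iota z.+1 d) = z + d.
Proof. by elim: d z => /= [|d IH] z; rewrite ?addn0 // IH addSnnS. Qed.

(** Labels for the path are read off [s] and those for the cycle off [c]; since
    [s] may be longer than the path, one sequence serves both parities of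
    [m]. *)
Lemma join_path_cycle_labelable m n K (s c : seq nat) :
  m <= size s -> n <= size c -> sorted coprime s ->
  {in c &, forall u v, u != v -> coprime u v} ->
  {in s & c, forall u v, coprime u v} ->
  uniq (s ++ c) -> all [pred x | 0 < x <= K] (s ++ c) ->
  coprime_labelable (join_graph (path_graph m) (cycle_graph n)) K.
Proof.
move=> ms nc ss cc sc us bs.
have icast k (i : 'I_k) z : k <= z -> i < z by apply: leq_trans.
pose g (v : join_graph (path_graph m) (cycle_graph n)) : nat :=
  match v with inl i => nth 0 s i | inr j => nth 0 c j end.
have gs i : g (inl i) \in s by rewrite mem_nth // icast.
have gc j : g (inr j) \in c by rewrite mem_nth // icast.
have gK v : 0 < g v <= K.
  by apply: (allP bs); rewrite mem_cat; case: v => [i|j]; rewrite ?gs ?gc ?orbT.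
move: (us); rewrite cat_uniq => /and3P[us1 /hasPn dis uc1].
have g_inj : injective g.
  case=> [i|i] [j|j] //.
  - by move/eqP; rewrite nth_uniq ?icast // => /eqP/val_inj->.
  - by move=> e; have /negP[] := dis _ (gc j); rewrite -e; apply: gs.
  - by move=> e; have /negP[] := dis _ (gc i); rewrite e; apply: gs.
  - by move/eqP; rewrite nth_uniq ?icast // => /eqP/val_inj->.
apply/andP; split.
  rewrite card_sum !card_ord; apply: leq_trans (leq_add ms nc) _.
  rewrite -size_cat -[leqRHS](size_iota 1); apply: uniq_leq_size => // x xs.
  by have := allP bs x xs; rewrite mem_iota /=; lia.
pose f := [ffun v => inord (g v) : 'I_K.+1].
have fE v : f v = g v :> nat.
  by rewrite ffunE inordK // ltnS; case/andP: (gK v).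
have path_coprime (i j : 'I_m) : i.+1 == j :> nat -> coprime (nth 0 s i) (nth 0 s j).
  move=> /eqP ij; rewrite -ij; move/(sortedP 0): ss; apply.
  by rewrite ij icast.
apply/existsP; exists f; apply/and3P; split.
- by apply/injectiveP => u v /(congr1 val) /=; rewrite !fE => /g_inj.
- by apply/forallP => v; rewrite fE; case/andP: (gK v).
- apply/forallP => u; apply/forallP => v; apply/implyP; rewrite !fE.
  case: u v => [i|i] [j|j] /=.
  + by case/orP => /path_coprime //; rewrite coprime_sym.
  + by move=> _; apply: sc (gs i) (gc j).
  + by move=> _; rewrite coprime_sym; apply: sc (gs j) (gc i).
  + case/andP => ij _; apply: cc (gc i) (gc j) _.
    by rewrite nth_uniq ?icast.
Qed.

(** Of the numbers 2, ..., [2Y - 1], the path loses the [n - 1] primes given to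
    the cycle and one even number for each of these primes except [q]; the
    [2Y + 1 - 2n] others remain, whence the bound on [m]. *)
Lemma join_path_cycle_labelable_of_primes m n Y : 3 <= Y -> 2 <= n ->
  m + 2 * n <= 2 * Y + 1 -> n.-1 <= count prime (iota Y.+1 Y) ->
  coprime_labelable (join_graph (path_graph m) (cycle_graph n)) (2 * Y).-1.
Proof.
move=> Y3 n2 mnY cY.
pose Q p := prime p && (Y < p).
have Q_odd p : Q p -> odd p.
  by case/andP=> pp Yp; case: (even_prime pp) => // p2; lia.
have [q [qY Qq cq]] : exists q, [/\ q < (2 * Y).+1, Q q & count Q (iota 0 q) = n.-2].
  apply: count_iota_eq; rewrite (_ : (2 * Y).+1 = Y.+1 + Y); last by lia.
  rewrite iotaD count_cat add0n (@eq_in_count _ Q prime (iota Y.+1 Y)).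
    by apply: leq_trans (leq_addl _ _); apply: leq_trans cY; lia.
  by move=> p; rewrite mem_iota /Q => /andP[-> _]; rewrite andbT.
have [pq Yq] := andP Qq; have oq := Q_odd q Qq.
have [|||L [pL aL sL]] := @increasing_coprime_chain Q Q_odd _ _ q oq.
- by move=> p /andP[_]; lia.
- move=> p /andP[pp Yp]; rewrite dvdn_prime2 //; lia.
- by lia.
move: pL; rewrite rcons_path => /andP[pL _].
have L2 : all (ltn 2) L.
  apply: (order_path_min ltn_trans).
  by apply: sub_path pL => a b /andP[].
(* The first part contains no removed prime because [q] is the greatest; it
   ends with the odd number 2Y - 1, which is coprime to 2.  It is empty when
   q = 2Y - 1. *)
pose s := iota q.+1 ((2 * Y).-1 - q) ++ 2 :: L.
pose c := 1 :: filter Q (iota 0 q.+1).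
have s_bound x : x \in s -> [&& 1 < x, x < 2 * Y, x != q & Q x ==> (q < x)].
  rewrite mem_cat mem_iota inE => /or3P[xq|/eqP->|xL].
  - by case: (Q x) => /=; lia.
  - by rewrite /Q /=; lia.
  - have := allP aL x xL; have := allP L2 x xL => /= x2 /andP[xq /negbTE->] /=.
    by lia.
have c_bound x : x \in c -> x = 1 \/ Q x /\ x <= q.
  rewrite inE mem_filter mem_iota => /orP[/eqP->|/and3P[Qx _ xq]]; first by left.
  by right.
have c_lt x : x \in c -> 0 < x < 2 * Y.
  by move=> /c_bound[->|[/andP[_ Yx] xq]]; lia.
have coprime_c u v : v \in c -> 0 < u -> u < 2 * Y -> u != v -> coprime u v.
  move=> /c_bound[-> *|[/andP[pv Yv] vq] u0 uY uv]; first by rewrite coprimen1.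
  by apply: coprime_prime_lt_double => //; lia.
have s_neq_c u v : u \in s -> v \in c -> u != v.
  move=> /s_bound/and4P[u1 uY uq Qu] /c_bound[->|[Qv vq]]; first by lia.
  by apply: contraTneq Qu => ->; rewrite Qv /=; lia.
apply: (@join_path_cycle_labelable _ _ _ s c).
- by rewrite size_cat size_iota /=; lia.
- have -> : size c = (count Q (iota 0 q.+1)).+1 by rewrite /= size_filter.
  by rewrite -(addn1 q) iotaD count_cat cq /= add0n Qq; lia.
(* Prepending [q] lets the junction with 2 be read off [last] even when the
   first part is empty. *)
- apply: (@path_sorted _ _ q); rewrite cat_path; apply/andP; split.
    exact: path_coprime_iota.
  rewrite last_iotaS subnKC; last by lia.
  rewrite /= coprimen2; apply/andP; split; first by lia.
  by apply: sub_path pL => a b /andP[].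
- move=> u v uc vc uv; have /andP[u0 uY] := c_lt u uc; exact: coprime_c.
- move=> u v us vc; have /and4P[u1 uY _ _] := s_bound u us.
  by apply: coprime_c => //; [exact: ltnW | exact: s_neq_c].
- rewrite cat_uniq; apply/and3P; split.
  + rewrite cat_uniq iota_uniq cons_uniq; apply/and3P; split=> //.
    * apply/hasPn => x; rewrite inE mem_iota => /orP[/eqP->|xL]; first by lia.
      by have /andP[xq _] := allP aL x xL; lia.
    * apply/andP; split; first by apply/negP => /(allP L2); rewrite /= ltnn.
      apply: (sorted_uniq ltn_trans ltnn); apply: (@path_sorted _ _ 2).
      by apply: sub_path pL => a b /andP[].
  + apply/hasPn => v vc; apply/negP => vs.
    by have := s_neq_c v v vs vc; rewrite eqxx.
  + by rewrite /= mem_filter /= filter_uniq ?iota_uniq.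
- rewrite all_cat; apply/andP; split; apply/allP => x.
    by move=> /s_bound /= /and4P[]; lia.
  by move=> /c_lt /=; lia.
Qed.

(** * Parity lower bound *)

Lemma card_half_inj (T : finType) (A : {set T}) (g : T -> nat) k :
  {in A &, injective (fun x => (g x)./2)} -> {in A, forall x, (g x)./2 < k} ->
  #|A| <= k.
Proof.
move=> g_inj gk; rewrite -(size_iota 0 k) cardE -(size_map (fun x => (g x)./2)).
apply: uniq_leq_size => [|_ /mapP[x xA ->]].
  by rewrite map_inj_in_uniq ?enum_uniq // => x y; rewrite !mem_enum; apply: g_inj.
by rewrite mem_iota gk // -mem_enum.
Qed.

(** Two distinct numbers with the same half are consecutive, so halving is
    injective on [A].  This covers independent sets of paths, and those of
    cycles up to one unit. *)
Lemma card_no_consecutive k (A : {set 'I_k}) :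
  (forall i j : 'I_k, i.+1 = j -> ~~ ((i \in A) && (j \in A))) -> #|A| <= uphalf k.
Proof.
move=> indep; apply: (@card_half_inj _ _ (@nat_of_ord k)) => [i j iA jA ij|i _].
  have [e|[e|e]] : i.+1 = j \/ j.+1 = i \/ i = j :> nat by lia.
  - by have := indep i j e; rewrite iA jA.
  - by have := indep j i e; rewrite iA jA.
  - exact: val_inj.
by have := ltn_ord i; lia.
Qed.

Lemma card_set_predC (T : finType) (P : pred T) :
  #|[set x | P x]| + #|[set x | ~~ P x]| = #|T|.
Proof.
rewrite -(cardsC [set x | P x]); congr (_ + #|pred_of_set _|).
by apply/setP => x; rewrite !inE.
Qed.

(** Even labels occur on one side of the join only; counting the odd labels
    that remain, the bound is reached when they occur on the path.  The
    assumption on [m] makes even labels on the cycle at least as costly. *)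
Lemma join_path_cycle_labelable_ge m n k : 2 * uphalf n <= m ->
  coprime_labelable (join_graph (path_graph m) (cycle_graph n)) k ->
  (m./2 + n).*2 <= k.+1.
Proof.
move=> nm /andP[_ /existsP[f /and3P[/injectiveP f_inj _ /forallP f_cop]]].
have even_adj u v : adj u v -> ~~ (~~ odd (f u) && ~~ odd (f v)).
  move=> uv; have /forallP/(_ v) := f_cop u; rewrite uv /= => cuv.
  apply/negP => /andP[eu ev].
  have : 2 %| gcdn (f u) (f v) by rewrite dvdn_gcd !dvdn2 eu ev.
  by rewrite (eqP cuv).
have path_even : #|[set i : 'I_m | ~~ odd (f (inl i))]| <= uphalf m.
  apply: card_no_consecutive => i j ij; rewrite !inE; apply: even_adj.
  by rewrite /= /path_rel ij eqxx.
have cycle_even : #|[set i : 'I_n | ~~ odd (f (inr i))]| <= uphalf n.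
  apply: card_no_consecutive => i j ij; rewrite !inE; apply: even_adj.
  rewrite /= /cycle_rel -!val_eqE /= ij modn_small ?ltn_ord // eqxx andbT.
  by rewrite -ij neq_ltn ltnSn.
have odds : #|[set v | odd (f v)]| <= uphalf k.
  apply: (@card_half_inj _ _ (fun v => f v : nat)) => [u v|v].
    rewrite !inE /= => ou ov e; apply/f_inj/val_inj => /=.
    by rewrite -(odd_double_half (f u)) -(odd_double_half (f v)) ou ov e.
  rewrite inE /=; move: (nat_of_ord (f v)) (ltn_ord (f v)) => z zk oz; lia.
have cardE : #|[set v | odd (f v)]| = #|[set i : 'I_m | odd (f (inl i))]| +
    #|[set i : 'I_n | odd (f (inr i))]|.
  by rewrite -!sum1dep_card big_sumType.
have path_odd : #|[set i : 'I_m | odd (f (inl i))]| +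
    #|[set i : 'I_m | ~~ odd (f (inl i))]| = m.
  by rewrite card_set_predC card_ord.
have cycle_odd : #|[set i : 'I_n | odd (f (inr i))]| +
    #|[set i : 'I_n | ~~ odd (f (inr i))]| = n.
  by rewrite card_set_predC card_ord.
have [c0|] := eqVneq [set i : 'I_n | ~~ odd (f (inr i))] set0.
  rewrite c0 cards0 in cycle_odd; lia.
case/set0Pn => j; rewrite inE => ej.
have p0 : [set i : 'I_m | ~~ odd (f (inl i))] = set0.
  apply/setP => i; rewrite !inE; apply/negbTE/negP => ei.
  by have := even_adj (inl i) (inr j) isT; rewrite ei ej.
rewrite p0 cards0 in path_odd; lia.
Qed.

(** * Primes between [y] and [2y] *)

(** From [(y, 2y]] to [(y + 1, 2y + 2]] the new candidates are [2y + 1] and the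
    composite number [2y + 2]. *)
Lemma count_prime_step y : 0 < y ->
  count prime (iota y.+2 y.+1) <= (count prime (iota y.+1 y)).+1.
Proof.
move=> y0.
have : count prime (iota y.+1 (y + 2)) = prime y.+1 + count prime (iota y.+2 y.+1).
  by rewrite addn2.
rewrite iotaD count_cat (_ : y.+1 + y = y.*2.+1); last by rewrite -addnn.
have /negbTE e : ~~ prime y.*2.+2.
  by apply/negP => /even_prime[]; rewrite /= ?odd_double //; lia.
by rewrite /= e; lia.
Qed.

Lemma count_prime_sub y j k : 0 < y -> k <= count prime (iota (y + j).+1 (y + j)) ->
  k - j <= count prime (iota y.+1 y).
Proof.
move=> y0; elim: j k => [|j IH] k; first by rewrite addn0 subn0.
rewrite addnS => kj; have := count_prime_step (y + j) ltac:(lia) => h.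
by have := IH k.-1 ltac:(lia); lia.
Qed.

Lemma count_prime_le y : 1 < y -> count prime (iota y.+1 y) <= uphalf y.
Proof.
move=> y1; have : count odd (iota y.+1 y) <= uphalf y.
  elim/ltn_ind: (y) (y.+1) => {y1}-[|[|d]] //= IH z; first by case: (odd z).
  by have := IH d (leqnSn _) z.+2; case: (odd z) => /=; lia.
apply: leq_trans; rewrite (@eq_in_count _ _ (predI prime odd)).
  by apply: sub_count => x /andP[].
move=> x; rewrite mem_iota /= => xy; case px: (prime x) => //=.
by case: (even_prime px) => // x2; lia.
Qed.

Lemma ramanujan_bound_count (R : realType) k r y : ramanujan_bound R k r ->
  (r <= (2 * y)%:Z)%R -> k <= count prime (iota y.+1 y).
Proof.
move=> bnd ry; have /bnd : (r%:~R <= (2 * y)%:R :> R)%R by rewrite pmulrn ler_int.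
rewrite natrM mulrAC divff ?pnatr_eq0 // mul1r -natrM /prime_pi !natrK.
rewrite (_ : (2 * y).+1 = y.+1 + y); last by lia.
by rewrite iotaD count_cat add0n; lia.
Qed.

(** If [m <= N], the Ramanujan property would apply to every [y] with
    [3N <= 2y + 1].  For [N > 6] the smallest such [y] leaves fewer than [N - 1]
    odd numbers in [(y, 2y]]; the remaining [N] need an explicit interval
    with few primes. *)
Lemma ramanujan_bound_lower (R : realType) N r m :
  2 < N -> ramanujan_bound R N.-1 r -> (r <= (m + 2 * N - 1)%:Z)%R -> N < m.
Proof.
move=> N2 hr rm; rewrite ltnNge; apply/negP => mN.
have bad y : 3 * N <= 2 * y + 1 -> count prime (iota y.+1 y) < N.-1 -> False.
  move=> yN; rewrite ltnNge => /negP; apply; apply: ramanujan_bound_count hr _.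
  by lia.
have [N6|N6] := ltnP 6 N.
  apply: (bad (uphalf (3 * N - 1))); first by lia.
  by apply: leq_ltn_trans (count_prime_le _ _) _; lia.
have [E|[E|[E|E]]] : N = 3 \/ N = 4 \/ N = 5 \/ N = 6 by lia.
- by apply: (bad 5); rewrite E.
- by apply: (bad 6); rewrite E.
- by apply: (bad 7); rewrite E.
- by apply: (bad 9); rewrite E.
Qed.

Theorem corollary4p3 (R : realType) (N : nat) (hN : (2 <= N)%N)
  (r : int) (hr : is_ramanujan_prime R N.-1 r)
  (M : int) (hM : (r - 2 * N%:Z + 1 <= M)%R)
  (m : nat) (hm0 : (0 < m)%N) (hm : (M <= m%:Z)%R)
  (n : nat) (hn3 : (3 <= n)%N) (hnN : (n <= N)%N) :
  min_coprime_number (join_graph (path_graph m) (cycle_graph n)) =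
    (if odd m then m + 2 * n - 2 else m + 2 * n - 1)%N.
Proof.
have rm : (r <= (m + 2 * N - 1)%:Z)%R by lia.
have bnd := hr.1.
have mN := ramanujan_bound_lower R N r m ltac:(lia) bnd rm.
(* For n = N and m odd, the claimed value 2Y - 1 may be r - 1; the primes up to
   it are nevertheless those up to the even number 2Y. *)
pose Y := m./2 + n.
rewrite (_ : (if _ then _ else _) = (2 * Y).-1); last by rewrite /Y; case: ifP; lia.
apply/eqP; rewrite eqn_leq /min_coprime_number; case: ex_minnP => k kl kmin.
apply/andP; split; last first.
  have := join_path_cycle_labelable_ge m n k ltac:(lia) kl.
  by rewrite /Y; lia.
apply: kmin; apply: join_path_cycle_labelable_of_primes; rewrite ?/Y; try lia.
have -> : n.-1 = N.-1 - (N - n) by lia.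
apply: count_prime_sub; first by lia.
by apply: ramanujan_bound_count bnd _; lia.
Qed.
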